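(* Assume $\mathcal Y=\{0,1\}$. Let $\ell^{\mathrm{add}}(d;\boldsymbol y,\boldsymbol x)=\varpi(\boldsymbol y,\boldsymbol x)+\sum_{k\in\mathcal D}\omega_k(d,y_k,\boldsymbol x)$ be an additive counterfactual loss, with $\omega_k:\mathcal D\times\mathcal Y\times\mathcal X\to\mathbb R$ and $\varpi:\mathcal Y^{\mathcal D}\times\mathcal X\to\mathbb R$ bounded measurable. Then for every $P\in\mathcal P$ and policy $\pi:\mathcal X\to\Delta(\mathcal D)$, the conditional counterfactual risk can be written, for $P_{\boldsymbol X}$-almost every $\boldsymbol x$, as $$\begin{aligned}R_{P_{Y(\mathcal D)\mid\boldsymbol X=\boldsymbol x}}(\pi;\ell^{\mathrm{add}})={}&\sum_{d\in\mathcal D}\zeta_d(d,\boldsymbol x)\,P^\pi(D^\pi=d,Y(d)=1\mid\boldsymbol X=\boldsymbol x)\\&+\sum_{d\in\mathcal D}\sum_{k\in\mathcal D,\,k\ne d}\zeta_k(d,\boldsymbol x)\,P^\pi(D^\pi=d,Y(k)=1\mid\boldsymbol X=\boldsymbol x)\\&+\sum_{d\in\mathcal D}\xi(d,\boldsymbol x)\,P^\pi(D^\pi=d\mid\boldsymbol X=\boldsymbol x)+C_{P_{Y(\mathcal D)\mid\boldsymbol X}}(\boldsymbol x),\end{aligned}$$ where $$\zeta_k(d,\boldsymbol x)=\omega_k(d,1,\boldsymbol x)-\omega_k(d,0,\boldsymbol x),\qquad \xi(d,\boldsymbol x)=\sum_{k\in\mathcal D}\omega_k(d,0,\boldsymbol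 x),$$ $$C_{P_{Y(\mathcal D)\mid\boldsymbol X}}(\boldsymbol x)=\sum_{\boldsymbol y\in\{0,1\}^K}\varpi(\boldsymbol y,\boldsymbol x)\,P(Y(\mathcal D)=\boldsymbol y\mid\boldsymbol X=\boldsymbol x).$$
   Context: Setup. Let $\mathcal X$ be an arbitrary measurable space, $K\ge 2$ an integer, $\mathcal D=\{0,\dots,K-1\}$ (decisions), $\mathcal Y=\{0,1\}$ (outcomes). $\Delta(S)$ denotes the set of probability measures on $S$. Potential outcomes are $Y(k)\in\mathcal Y$, $k\in\mathcal D$, with $Y(\mathcal D)=(Y(0),\dots,Y(K-1))\in\mathcal Y^{\mathcal D}$; covariates are $\boldsymbol X\in\mathcal X$; $D\in\mathcal D$ is the observed decision. Given a law $P_{Y(\mathcal D),\boldsymbol X}\in\Delta(\mathcal Y^{\mathcal D}\times\mathcal X)$ and a treatment assignment mechanism (a measurable map $e:\mathcal Y^{\mathcal D}\times\mathcal X\to\Delta(\mathcal D)$), the joint law $P=e\cdot P_{Y(\mathcal D),\boldsymbol X}$ of $(D,Y(\mathcal D),\boldsymbol X)$ is $$P(D=k,Y(\mathcal D)=\boldsymbol y,\boldsymbol X\in A)=\int_A e(k;\boldsymbol y,\boldsymbol x)\,P_{Y(\mathcal D)\mid\boldsymbol X}(Y(\mathcal D)=\boldsymbol y\mid\boldsymbol X=\boldsymbol x)\,dP_{\boldsymbol X}(\boldsymbol x)$$ for $A\subseteq\mathcal X$ measurable. Strong ignorability of $e$ with respect to $P_{Y(\mathcal D),\boldsymbol X}$: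 (a) unconfoundedness, $e(d;\boldsymbol y,\boldsymbol x)=e(d;\boldsymbol x)$ for every $d\in\mathcal D$, $P_{Y(\mathcal D),\boldsymbol X}$-a.s.; (b) overlap, $e(d;\boldsymbol x)>0$ for every $d\in\mathcal D$, $P_{\boldsymbol X}$-a.s. $\mathcal P$ is the set of all joint laws $P=e\cdot P_{Y(\mathcal D),\boldsymbol X}$ with $P_{Y(\mathcal D),\boldsymbol X}\in\Delta(\mathcal Y^{\mathcal D}\times\mathcal X)$ arbitrary and $e$ strongly ignorable with respect to it. A policy is a (measurable) map $\pi:\mathcal X\to\Delta(\mathcal D)$, written $\pi(d;\boldsymbol x)$. It induces a decision $D^\pi$ with $D^\pi\mid\boldsymbol X=\boldsymbol x\sim\pi(\cdot;\boldsymbol x)$, independent of $Y(\mathcal D)$ given $\boldsymbol X$; the joint law $P^\pi$ of $(D^\pi,Y(\mathcal D),\boldsymbol X)$ is $$P^\pi(D^\pi=d,Y(\mathcal D)=\boldsymbol y,\boldsymbol X\in A)=\int_A\pi(d;\boldsymbol x)\,P_{Y(\mathcal D)\mid\boldsymbol X}(Y(\mathcal D)=\boldsymbol y\mid\boldsymbol X=\boldsymbol x)\,dP_{\boldsymbol X}(\boldsymbol x).$$ A counterfactual loss is a measurable function $\ell:\mathcal D\times\mathcal Y^{\mathcal D}\times\mathcal X\to\mathbb R$, assumed bounded. The conditional counterfactual risk is $$R_{P_{Y(\mathcal D)\mid\boldsymbol X=\boldsymbol x}}(\pi;\ell)=\sum_{d\in\mathcal D}\sum_{\boldsymbol y\in\mathcal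 Y^{\mathcal D}}\ell(d;\boldsymbol y,\boldsymbol x)\,\pi(d;\boldsymbol x)\,P(Y(\mathcal D)=\boldsymbol y\mid\boldsymbol X=\boldsymbol x)$$ (defined $P_{\boldsymbol X}$-a.s.). *)

(* Defs.v *)
From HB Require Import structures.
From mathcomp Require Import all_boot all_order all_algebra.
From mathcomp Require Import all_classical all_reals all_analysis.
Import numFieldNormedType.Exports.

Set Implicit Arguments.
Unset Strict Implicit.
Unset Printing Implicit Defensive.

Import Order.TTheory GRing.Theory Num.Theory.

Local Open Scope classical_set_scope.
Local Open Scope ring_scope.

(* The number of decisions is K = n.+2 >= 2.
   Decisions live in 'I_n.+2, outcomes in bool (true is outcome 1), and vectors
   of potential outcomes in n.+2.-tuple bool, with y_k = tnth y k. *)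

HB.instance Definition _ (n : nat) := isPointed.Build 'I_n.+1 ord0.

HB.instance Definition _ (n : nat) := @isMeasurable.Build
  default_measure_display 'I_n.+1 discrete_measurable discrete_measurable0
  discrete_measurableC discrete_measurableU.

Section conditional_probability.
Context d dX (R : realType) (S : measurableType d) (X : measurableType dX).

HB.instance Definition _ :=
  isMeasurableFun.Build _ _ _ _ (@snd S X) measurable_snd.

Definition covariate_law (P : probability (S * X)%type R) : probability X R :=
  distribution P (snd : {mfun (S * X)%type >-> X}).

(* f is a version of x |-> P(E | X = x), the covariate being the last
   coordinate of the sample space; versions are unique up to P_X-null sets. *)
Definition is_cond_prob (P : probability (S * X)%type R) (E : set (S * X))
    (f : X -> R) : Prop :=
  (covariate_law P).-integrable [set: X] (EFin \o f) /\
  forall A : set X, measurable A ->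
    P (E `&` snd @^-1` A) = (\int[covariate_law P]_(x in A) (f x)%:E)%E.

End conditional_probability.

Section counterfactual.
Context dX (R : realType) (X : measurableType dX) (n : nat).

Local Notation D := 'I_n.+2.
Local Notation Y := (n.+2.-tuple bool).

Definition is_cond_law (Q : probability (Y * X)%type R) (p : Y -> X -> R) :=
  forall y : Y, is_cond_prob Q [set z | z.1 = y] (p y).

(* P is the law of (D, Y(D), X) obtained when (Y(D), X) has law Q and, given
   Y(D) = y and X = x, decision k has probability w k y x. The value of the
   integral does not depend on the version p. *)
Definition is_joint_law (Q : probability (Y * X)%type R)
    (w : D -> Y -> X -> \bar R) (P : probability (D * Y * X)%type R) : Prop :=
  forall p : Y -> X -> R, is_cond_law Q p ->
  forall (k : D) (y : Y) (A : set X), measurable A ->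
    P [set z | [/\ z.1.1 = k, z.1.2 = y & A z.2]] =
    (\int[covariate_law Q]_(x in A) (w k y x * (p y x)%:E))%E.

Definition is_assignment_law (Q : probability (Y * X)%type R)
    (e : R.-pker (Y * X)%type ~> D) (P : probability (D * Y * X)%type R) :=
  is_joint_law Q (fun k y x => e (y, x) [set k]) P.

(* e0 plays the role of e(k; x), the assignment mechanism without y. *)
Definition strongly_ignorable (Q : probability (Y * X)%type R)
    (e : R.-pker (Y * X)%type ~> D) : Prop :=
  exists e0 : R.-pker X ~> D,
    (forall k : D, {ae Q, forall z, e z [set k] = e0 z.2 [set k]}) /\
    (forall k : D, {ae covariate_law Q, forall x, (0 < e0 x [set k])%E}).

Definition ignorable_laws : set (probability (D * Y * X)%type R) :=
  [set P | exists (Q : probability (Y * X)%type R)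
                  (e : R.-pker (Y * X)%type ~> D),
    strongly_ignorable Q e /\ is_assignment_law Q e P].

Definition drop_decision (z : D * Y * X) : Y * X := (z.1.2, z.2).

Lemma measurable_drop_decision : measurable_fun [set: D * Y * X] drop_decision.
Proof.
apply: measurable_fun_pair; last exact: measurable_snd.
exact: (measurableT_comp measurable_snd measurable_fst).
Qed.

HB.instance Definition _ :=
  isMeasurableFun.Build _ _ _ _ drop_decision measurable_drop_decision.

Definition outcome_law (P : probability (D * Y * X)%type R) :
    probability (Y * X)%type R :=
  distribution P (drop_decision : {mfun (D * Y * X)%type >-> (Y * X)%type}).

(* Ppi is the law of (D^pi, Y(D), X). *)
Definition is_policy_law (P : probability (D * Y * X)%type R)
    (pi : R.-pker X ~> D) (Ppi : probability (D * Y * X)%type R) :=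
  is_joint_law (outcome_law P) (fun k _ x => pi x [set k]) Ppi.

(* The argument p is the conditional law of Y(D) given X = x. *)
Definition cond_risk (p : Y -> X -> R) (pi : R.-pker X ~> D)
    (l : D * Y * X -> R) (x : X) : R :=
  \sum_(d : D) \sum_(y : Y) l (d, y, x) * fine (pi x [set d]) * p y x.

Definition additive_loss (omega : D -> D * bool * X -> R)
    (varpi : Y * X -> R) (z : D * Y * X) : R :=
  let: (d, y, x) := z in varpi (y, x) + \sum_(k : D) omega k (d, tnth y k, x).

Definition zeta (omega : D -> D * bool * X -> R) (k d : D) (x : X) : R :=
  omega k (d, true, x) - omega k (d, false, x).

Definition xi (omega : D -> D * bool * X -> R) (d : D) (x : X) : R :=
  \sum_(k : D) omega k (d, false, x).

Definition baseline (p : Y -> X -> R) (varpi : Y * X -> R) (x : X) : R :=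
  \sum_(y : Y) varpi (y, x) * p y x.

End counterfactual.

(* Main.v *)
Require Import Defs.
From mathcomp Require Import all_boot all_order all_algebra.
From mathcomp Require Import all_classical all_reals all_analysis.
From mathcomp Require Import measurable_realfun.
From mathcomp Require Import ring.
Import numFieldNormedType.Exports.
Import Order.TTheory GRing.Theory Num.Theory.
Local Open Scope classical_set_scope.
Local Open Scope ring_scope.

(** With binary outcomes, each weight is affine in the outcome:
    [omega_k(d, y_k) = omega_k(d, 0) + y_k * zeta_k(d)]. Summing over [k] gives
    [xi(d)] plus the [zeta_k(d)] with [y_k = 1]; multiplying by
    [pi(d; x) p(y; x)] and summing over [y] therefore only leaves the two kinds
    of quantities [pi(d; x) * sum_(y | y_k = 1) p(y; x)] and
    [pi(d; x) * sum_y p(y; x)], while the [varpi] part loses its dependence on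
    the policy because [sum_d pi(d; x) = 1]. This is a pointwise identity,
    [additive_risk_decomposition].

    The probabilistic content is that these products are versions of
    [P^pi(D^pi = d, Y(k) = 1 | X = x)] and [P^pi(D^pi = d | X = x)]; this is
    [policy_cond_prob], an instance of the conditional independence of [D^pi]
    and [Y(D)] given [X]. It follows from the almost sure uniqueness of
    conditional probabilities: [policy_law_event] computes [P^pi] of any event
    on [(D^pi, Y(D))] intersected with [X in A] as an integral over [A]. The
    uniqueness takes place under the covariate law of [P^pi], and the risk lives
    under that of [P], so [covariate_law_policy] is needed to identify
    the two: a policy does not change the distribution of the covariates. *)

Set Implicit Arguments.
Unset Strict Implicit.
Unset Printing Implicit Defensive.

(** * Finite partitions and probability kernels *)

Lemma measure_fin_partition (R : realType) d (T : measurableType d)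
    (mu : {measure set T -> \bar R}) (I : finType) (C : pred I)
    (E : I -> set T) :
  (forall i, measurable (E i)) ->
  (forall i j x, E i x -> E j x -> i = j) ->
  mu [set x | exists2 i, C i & E i x] = (\sum_(i | C i) mu (E i))%E.
Proof.
move=> mE E_disj; rewrite -big_enum fsbig_seq ?enum_uniq//.
rewrite -measure_fin_bigcup//.
- congr (mu _); apply/seteqP; split=> x /=.
    by move=> [i Ci Ex]; exists i => //=; rewrite mem_enum.
  by move=> [i /=]; rewrite mem_enum => Ci Ex; exists i.
- by move=> i j _ _ [x [Ei Ej]]; exact: E_disj Ei Ej.
Qed.

Section probability_kernel.
Context (R : realType) (d d' : measure_display).
Context (X : measurableType d) (Y : measurableType d') (pi : R.-pker X ~> Y).

Lemma prob_kernel_le1 (x : X) (U : set Y) : measurable U -> (pi x U <= 1)%E.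
Proof. by move=> mU; rewrite -(prob_kernel (s := pi) x) le_measure ?inE. Qed.

Lemma prob_kernel_fineK (x : X) (U : set Y) :
  measurable U -> (fine (pi x U))%:E = pi x U.
Proof.
move=> mU; rewrite fineK// ge0_fin_numE//.
by rewrite (le_lt_trans (prob_kernel_le1 x mU))// ltry.
Qed.

Lemma measurable_fine_kernel (U : set Y) :
  measurable U -> measurable_fun [set: X] (fun x => fine (pi x U)).
Proof.
move=> mU; apply/measurable_EFinP/(eq_measurable_fun (fun x => pi x U)).
  by move=> x _; rewrite /= prob_kernel_fineK.
exact: measurable_kernel.
Qed.

End probability_kernel.

Lemma sum_prob_kernel (R : realType) d (X : measurableType d) (n : nat)
    (pi : R.-pker X ~> 'I_n.+1) (x : X) :
  \sum_(k < n.+1) fine (pi x [set k]) = 1.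
Proof.
apply: EFin_inj; rewrite -sumEFin.
under eq_bigr do rewrite prob_kernel_fineK//.
rewrite -(@measure_fin_partition _ _ _ _ 'I_n.+1 xpredT (fun k => [set k]))//.
  rewrite -(prob_kernel (s := pi) x); congr (pi x _).
  by apply/seteqP; split => // k _; exists k.
by move=> i j k -> ->.
Qed.

Lemma measurable_tuple_set1 d (T : measurableType d) (n : nat)
    (y : n.-tuple T) :
  (forall t : T, measurable [set t]) -> measurable [set y].
Proof.
move=> mT; rewrite (_ : [set y] =
    \bigcap_(i in [set: 'I_n]) (fun u => tnth u i) @^-1` [set tnth y i]).
  apply: fin_bigcap_measurable => // i _.
  by rewrite -[X in measurable X]setTI; exact: measurable_tnth.
apply/seteqP; split=> u /=; first by move=> -> i _.
by move=> uy; apply: eq_from_tnth => i; exact: uy.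
Qed.

(** * The law induced by a policy *)

Section policy.
Context (R : realType) (dX : measure_display) (X : measurableType dX) (n : nat).
Local Notation D := 'I_n.+2.
Local Notation Y := (n.+2.-tuple bool).
Implicit Types (P : probability (D * Y * X)%type R).
Implicit Types (Q : probability (Y * X)%type R).
Implicit Types (pi : R.-pker X ~> D) (p : Y -> X -> R).

(** A joint law is specified on the atoms of [D * Y] only; finite additivity
    extends the formula to every event on [D * Y]. *)
Lemma joint_law_event Q w P p (C : pred (D * Y)) (A : set X) :
  is_joint_law Q w P -> is_cond_law Q p -> measurable A ->
  P ([set z | C z.1] `&` snd @^-1` A) =
  (\sum_(i | C i) \int[covariate_law Q]_(x in A)
     (w i.1 i.2 x * (p i.2 x)%:E))%E.
Proof.
move=> wP pQ mA.
have -> : [set z : D * Y * X | C z.1] `&` snd @^-1` A =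
    [set z | exists2 i, C i & [/\ z.1.1 = i.1, z.1.2 = i.2 & A z.2]].
  apply/seteqP; split=> -[[k y] x] /=; first by move=> [Cky Ax]; exists (k, y).
  by move=> [[k' y'] /= Ci [-> -> Ax]].
rewrite (@measure_fin_partition _ _ _ _ _ C
   (fun i => [set z | [/\ z.1.1 = i.1, z.1.2 = i.2 & A z.2]])).
- by apply: eq_bigr => i _; exact: wP.
- move=> [k y]; rewrite (_ : [set z | _] = ([set k] `*` [set y]) `*` A).
    apply: measurableX => //; apply: measurableX => //.
    exact: measurable_tuple_set1.
  by apply/seteqP; split=> -[[? ?] ?] /=; [move=> [-> ->]|move=> [[-> ->]]].
- by move=> [k y] [k' y'] [[? ?] ?] /= [-> -> _] [-> -> _].
Qed.

Lemma measurable_cond_law Q p (y : Y) :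
  is_cond_law Q p -> measurable_fun [set: X] (p y).
Proof. by move=> /(_ y)[/measurable_int/measurable_EFinP]. Qed.

Lemma integrable_policy_cond_law Q p pi (d : D) (y : Y) (A : set X) :
  is_cond_law Q p -> measurable A ->
  (covariate_law Q).-integrable A (fun x => (fine (pi x [set d]) * p y x)%:E).
Proof.
move=> pQ mA; apply: (@integrableS _ _ _ _ [set: X]) => //.
apply: (le_integrable _ _ _ (pQ y).1) => //.
  apply/measurable_EFinP/measurable_funM; first exact: measurable_fine_kernel.
  exact: measurable_cond_law pQ.
move=> x _; rewrite !abse_EFin lee_fin normrM ler_piMl//.
rewrite ger0_norm ?fine_ge0// -lee_fin prob_kernel_fineK//.
exact: prob_kernel_le1.
Qed.

Lemma policy_law_event Q p pi P (C : pred (D * Y)) (A : set X) :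
  is_joint_law Q (fun k _ x => pi x [set k]) P -> is_cond_law Q p ->
  measurable A ->
  P ([set z | C z.1] `&` snd @^-1` A) =
  (\int[covariate_law Q]_(x in A)
     (\sum_(i | C i) fine (pi x [set i.1]) * p i.2 x)%:E)%E.
Proof.
move=> piP pQ mA; rewrite (joint_law_event C piP pQ)//.
under [RHS]eq_integral do rewrite -sumEFin.
rewrite (integral_sum mA) => [|i]; last exact: integrable_policy_cond_law.
apply: eq_bigr => i _; apply: eq_integral => x _.
by rewrite EFinM prob_kernel_fineK.
Qed.

(** The integrated form of [\sum_y p y x = 1]: the events [Y(D) = y] partition
    the sample space. *)
Lemma covariate_law_cond_law Q p (A : set X) :
  is_cond_law Q p -> measurable A ->
  covariate_law Q A =
  (\int[covariate_law Q]_(x in A) (\sum_(y : Y) p y x)%:E)%E.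
Proof.
move=> pQ mA; under eq_integral do rewrite -sumEFin.
rewrite (integral_sum mA) => [|y]; last first.
  by apply: integrableS (pQ y).1.
rewrite (eq_bigr (fun y => Q [set z | z.1 = y /\ A z.2])) => [|y _]; last first.
  by rewrite -(pQ y).2.
rewrite -(@measure_fin_partition _ _ _ _ Y xpredT
   (fun y => [set z | z.1 = y /\ A z.2])).
- congr (Q _); apply/seteqP; split=> z /=; last by move=> [y _ []].
  by move=> Az; exists z.1.
- move=> y; rewrite (_ : [set z | _] = [set y] `*` A).
    by apply: measurableX => //; exact: measurable_tuple_set1.
  by apply/seteqP; split.
- by move=> y y' z [<- _] [<- _].
Qed.

(** A policy acts after the covariates are drawn: summing [pi(d; x) p(y; x)]
    over [d] gives back [p(y; x)]. *)
Lemma covariate_law_policy Q p pi P (A : set X) :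
  is_joint_law Q (fun k _ x => pi x [set k]) P -> is_cond_law Q p ->
  measurable A -> covariate_law P A = covariate_law Q A.
Proof.
move=> piP pQ mA.
rewrite (covariate_law_cond_law pQ mA).
have -> : covariate_law P A = P ([set z | xpredT z.1] `&` snd @^-1` A).
  by congr (P _); apply/seteqP; split=> [z Az|z []].
rewrite (policy_law_event xpredT piP pQ mA).
apply: eq_integral => x _; congr EFin.
rewrite -(pair_bigA _ (fun d y => fine (pi x [set d]) * p y x))/=.
rewrite exchange_big /=; apply: eq_bigr => y _.
by rewrite -mulr_suml sum_prob_kernel mul1r.
Qed.

(** Given [X], the decision of a policy is independent of the potential
    outcomes. Both sides have the same integral over every measurable set of
    covariates, and an integrable function is determined almost everywhere by
    these integrals. *)
Lemma policy_cond_prob Q p pi P (d : D) (B : pred Y) (s : X -> R) :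
  is_joint_law Q (fun k _ x => pi x [set k]) P -> is_cond_law Q p ->
  is_cond_prob P [set z | z.1.1 = d /\ B z.1.2] s ->
  {ae covariate_law Q, forall x,
    s x = fine (pi x [set d]) * \sum_(y | B y) p y x}.
Proof.
move=> piP pQ [s_int sP].
pose g x := fine (pi x [set d]) * \sum_(y | B y) p y x.
have s_g : ae_eq (covariate_law P) [set: X] (EFin \o s) (EFin \o g).
  apply: integral_ae_eq => //.
    apply/measurable_EFinP/measurable_funM; first exact: measurable_fine_kernel.
    under eq_fun do rewrite -big_filter.
    apply: measurable_sum => y; exact: measurable_cond_law pQ.
  move=> A _ mA; rewrite -sP//.
  rewrite (eq_measure_integral (covariate_law Q)) => [|U mU _]; last first.
    exact: covariate_law_policy piP pQ mU.
  have := policy_law_event [pred i | (i.1 == d) && B i.2] piP pQ mA.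
  rewrite (_ : [set z | _] = [set z | z.1.1 = d /\ B z.1.2]); last first.
    apply/seteqP; split=> z /=; first by move=> /andP[/eqP].
    by move=> [-> ->]; rewrite eqxx.
  move=> ->; apply: eq_integral => x _; congr EFin.
  rewrite -(pair_big (pred1 d) B (fun k y => fine (pi x [set k]) * p y x))/=.
  by rewrite big_pred1_eq /g mulr_sumr.
(* The two covariate laws agree on measurable sets, hence on null sets. *)
case: s_g => N [mN N0 sN]; exists N; split => //.
  by rewrite -(covariate_law_policy piP pQ mN).
apply: subset_trans sN => x /= sgx sg; apply: sgx.
exact: EFin_inj (sg I).
Qed.

(** * The additive risk *)

(** Since [pi] sums to 1, the baseline is an average over decisions, and the
    identity can be checked one decision and one outcome vector at a time. There
    it is the affine form of a weight in a binary outcome, summed over [k]. *)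
Lemma additive_risk_decomposition (omega : D -> D * bool * X -> R)
    (varpi : Y * X -> R) p pi (x : X) :
  cond_risk p pi (additive_loss omega varpi) x =
  \sum_(d < n.+2) \sum_(k < n.+2)
      zeta omega k d x * (fine (pi x [set d]) * \sum_(y | tnth y k) p y x)
  + \sum_(d < n.+2) xi omega d x * (fine (pi x [set d]) * \sum_y p y x)
  + baseline p varpi x.
Proof.
have -> : baseline p varpi x =
    \sum_(d < n.+2) fine (pi x [set d]) * baseline p varpi x.
  by rewrite -mulr_suml sum_prob_kernel mul1r.
rewrite -!big_split; apply: eq_bigr => d _ /=.
have zetaE k : zeta omega k d x *
      (fine (pi x [set d]) * \sum_(y | tnth y k) p y x) =
    \sum_(y : Y) (tnth y k)%:R * zeta omega k d x *
      (fine (pi x [set d]) * p y x).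
  rewrite big_mkcond !mulr_sumr; apply: eq_bigr => y _.
  by case: (tnth y k); rewrite ?mul1r ?mul0r ?mulr0.
rewrite (eq_bigr _ (fun k _ => zetaE k)) exchange_big /baseline !mulr_sumr.
rewrite -!big_split; apply: eq_bigr => y _ /=.
have omegaE : \sum_(k < n.+2) omega k (d, tnth y k, x) =
    \sum_(k < n.+2) (tnth y k)%:R * zeta omega k d x + xi omega d x.
  rewrite /xi -big_split; apply: eq_bigr => k _ /=.
  by rewrite /zeta; case: (tnth y k); rewrite ?mul1r ?mul0r; ring.
by rewrite omegaE -mulr_suml; ring.
Qed.

End policy.

Theorem corollary3 (R : realType) (dX : measure_display)
    (X : measurableType dX) (n : nat)
    (omega : 'I_n.+2 -> 'I_n.+2 * bool * X -> R)
    (varpi : n.+2.-tuple bool * X -> R)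
    (omega_meas : forall k, measurable_fun [set: 'I_n.+2 * bool * X] (omega k))
    (omega_bnd : forall k,
      [bounded omega k z | z in [set: 'I_n.+2 * bool * X]])
    (varpi_meas : measurable_fun [set: n.+2.-tuple bool * X] varpi)
    (varpi_bnd : [bounded varpi z | z in [set: n.+2.-tuple bool * X]])
    (P : probability ('I_n.+2 * n.+2.-tuple bool * X)%type R)
    (P_ignorable : ignorable_laws P)
    (pi : R.-pker X ~> 'I_n.+2)
    (Ppi : probability ('I_n.+2 * n.+2.-tuple bool * X)%type R)
    (Ppi_law : is_policy_law P pi Ppi)
    (p : n.+2.-tuple bool -> X -> R)
    (p_cond : is_cond_law (outcome_law P) p)
    (q : 'I_n.+2 -> 'I_n.+2 -> X -> R)
    (q_cond : forall d k : 'I_n.+2,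
      is_cond_prob Ppi [set z | z.1.1 = d /\ tnth z.1.2 k = true] (q d k))
    (r : 'I_n.+2 -> X -> R)
    (r_cond : forall d : 'I_n.+2, is_cond_prob Ppi [set z | z.1.1 = d] (r d)) :
  {ae covariate_law P, forall x,
    cond_risk p pi (additive_loss omega varpi) x =
      \sum_(d < n.+2) zeta omega d d x * q d d x
      + \sum_(d < n.+2) \sum_(k < n.+2 | k != d) zeta omega k d x * q d k x
      + \sum_(d < n.+2) xi omega d x * r d x
      + baseline p varpi x}.
Proof.
(* The covariate laws of P and of outcome_law P are convertible as set
   functions, which lets policy_cond_prob speak of the former. *)
have qE d : {ae covariate_law P, forall x, forall k,
    q d k x = fine (pi x [set d]) * \sum_(y | tnth y k) p y x}.
  apply: filter_forall => k.
  exact: (policy_cond_prob (B := fun y => tnth y k) Ppi_law p_cond (q_cond d k)).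
have rE d : {ae covariate_law P, forall x,
    r d x = fine (pi x [set d]) * \sum_y p y x}.
  have dT : [set z : 'I_n.+2 * n.+2.-tuple bool * X | z.1.1 = d] =
      [set z | z.1.1 = d /\ xpredT z.1.2].
    by apply/seteqP; split=> z // -[].
  have := r_cond d; rewrite dT.
  exact: (policy_cond_prob (B := xpredT) Ppi_law p_cond).
have qrE : {ae covariate_law P, forall x, forall d,
    (forall k, q d k x = fine (pi x [set d]) * \sum_(y | tnth y k) p y x) /\
    r d x = fine (pi x [set d]) * \sum_y p y x}.
  by apply: filter_forall => d; apply: filterI; [exact: qE|exact: rE].
apply: filterS qrE => x qrE; rewrite additive_risk_decomposition.
rewrite -[X in _ = X + _ + _]big_split.
congr (_ + _ + _); apply: eq_bigr => d _; last by rewrite (qrE d).2.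
rewrite /= (bigD1 d)//= (qrE d).1; congr (_ + _).
by apply: eq_bigr => k _; rewrite (qrE d).1.
Qed.
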